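(* Let $d \ge 5$ be fixed, and let $\tau = \log_d(n) - \log\log\log(n) - \log(\omega_n)$, where $\omega_n \to \infty$ as $n \to \infty$. With high probability any induced subgraph of $\mathrm{ER}(n,d/n)$ all of whose connected components have size at most $\tau$ has size at most $$\frac{2}{d}\left(\log d + 2 - \log 2\right) n .$$
   Context: The size of a (sub)graph is its number of vertices. $\mathrm{ER}(n,p)$ denotes the Erdős–Rényi random graph on $n$ vertices in which every pair of vertices is independently included as an edge with probability $p$. A sequence of events $E_n$ occurs with high probability if $\mathbb{P}[E_n]\to 1$ as $n \to \infty$. $\log$ is the natural logarithm and $\log_d$ is the logarithm to base $d$. *)

(* Defs.v *)
From mathcomp Require Import all_boot all_order all_algebra.
From mathcomp Require Import all_classical all_reals all_analysis.

Set Implicit Arguments.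
Unset Strict Implicit.
Unset Printing Implicit Defensive.

Import Order.TTheory GRing.Theory Num.Theory.
Import numFieldNormedType.Exports.

Local Open Scope ring_scope.

Definition vertex_pairs (n : nat) : {set {set 'I_n}} :=
  [set e : {set 'I_n} | #|e| == 2%N].

(* A simple graph on the vertex set 'I_n is represented by its edge set
   G \subset vertex_pairs n. *)
Definition induced_adj (n : nat) (G : {set {set 'I_n}}) (S : {set 'I_n}) :
    rel 'I_n :=
  fun x y => [&& x \in S, y \in S & [set x; y] \in G].

Definition components (n : nat) (G : {set {set 'I_n}}) (S : {set 'I_n}) :
    {set {set 'I_n}} :=
  equivalence_partition (connect (induced_adj G S)) S.

(* The summand is the product law under which each pair is an edge with
   probability p.  For p outside [0, 1] it is only a signed weight of total
   mass 1; with p = d / n and d fixed, this concerns finitely many n. *)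
Definition ER_prob (R : realType) (n : nat) (p : R)
    (A : pred {set {set 'I_n}}) : R :=
  \sum_(G : {set {set 'I_n}} | (G \subset vertex_pairs n) && A G)
    \prod_(e in vertex_pairs n) (if e \in G then p else 1 - p).

Definition with_high_probability (R : realType) (p : nat -> R)
    (A : forall n : nat, pred {set {set 'I_n}}) : Prop :=
  (ER_prob (p n) (@A n) @[n --> \oo] --> (1 : R))%classic.

Definition log_base (R : realType) (b x : R) : R := ln x / ln b.

(* Main.v *)
Require Import Defs.
From mathcomp Require Import all_boot all_order all_algebra.
From mathcomp Require Import all_classical all_reals all_analysis.
From mathcomp Require Import ring lra.
Import Order.TTheory GRing.Theory Num.Theory.
Import numFieldNormedType.Exports.
(* Restores the finite-set meaning of names such as set0, setUC and subsetP,
   which also exist for classical sets. *)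
Import boot.fintype boot.finset.
Set Implicit Arguments.
Unset Strict Implicit.
Unset Printing Implicit Defensive.
Local Open Scope ring_scope.

(** Write L = ln d + 2 - ln 2 and alpha = 2 L / d, so that the claimed bound is
alpha n.

A graph spanned by small components has few edges.  Choose a path from every
vertex to the root of its component.  An edge that is the first edge of neither
of the paths chosen at its two ends can be bypassed, hence lies on a cycle; and a
cycle stays inside one component, so it has length at most tau.  Thus the number
of edges inside S is at most |S| + X, where X counts the cycles of length at most
tau in the whole graph, with their roots and orientations (forest_or_cycle,
edges_small_components).  The same bound holds inside every subset of S, because its cycles are still cycles of S; so it
suffices to exclude sets of the single size s = floor (alpha n) + 1.

Short cycles are rare: a fixed cycle of length k is present with probability
(d / n) ^ k and there are at most n ^ k of them, so E[X] is at most
the geometric sum of the d ^ k for k <= tau, which is at most twice the last term,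
and that is at most 1 + n / omega (expr_cycle_length_le).  By Markov's inequality
X < eps n with high probability, for every fixed eps > 0.

Sets of size s with few edges are rare as well.  By Chernoff's bound with the
parameter 1 / L, a given set spans at most s + eps n edges with probability at
most L ^ (s + eps n) (1 - (d / n) (1 - 1 / L)) ^ binomial(s, 2), and the number of
sets of size s is at most (1 + alpha) ^ n / alpha ^ s.  The constant alpha is the
one for which everything of order n in the exponent of the product collapses to
n (ln (1 + alpha) - alpha + eps ln L), and ln (1 + alpha) < alpha strictly
(entropy_exponent, first_moment_le).  So for small eps the union bound is
exponentially small.

Both failures are handled at once: the indicator of a bad graph is at most
X / (eps n) plus the sum of the Chernoff weights of the sets of size s, and the
expectation of this quantity tends to 0 (ER_prob_small_components_ge). *)

(** * Edges of paths and cycles *)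

Fixpoint path_edges (T : finType) (x : T) (p : seq T) : {set {set T}} :=
  if p is y :: q then [set x; y] |: path_edges y q else set0.

Definition cycle_edges (T : finType) (x : T) (p : seq T) : {set {set T}} :=
  [set x; last x p] |: path_edges x p.

Lemma path_edges_mem (T : finType) (x : T) p e z :
  e \in path_edges x p -> z \in e -> z \in x :: p.
Proof.
elim: p x => [|y q IH] x /=; first by rewrite inE.
rewrite in_setU1 => /orP[/eqP ->|/IH h].
  by rewrite !inE => /orP[] ->; rewrite ?orbT.
by move=> /h; rewrite [in X in _ -> X]in_cons => ->; rewrite orbT.
Qed.

Lemma notin_path_edges (T : finType) (x y z : T) p :
  x \notin y :: p -> [set x; z] \notin path_edges y p.
Proof.
by apply: contra => /path_edges_mem; apply; rewrite set21.
Qed.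

(** Each new edge contains the starting vertex, which a simple path never visits
again. *)
Lemma card_path_edges (T : finType) (x : T) p :
  uniq (x :: p) -> #|path_edges x p| = size p.
Proof.
elim: p x => [|y q IH] x; first by rewrite cards0.
rewrite cons_uniq => /andP[xNyq uyq] /=.
by rewrite cardsU1 notin_path_edges // IH.
Qed.

(** A rooted cycle is stored as a simple path x :: p whose closing edge joins the
last vertex to x.  That edge is new as soon as the path has at least two edges:
the only path edge containing x is the first one. *)
Lemma card_cycle_edges (T : finType) (x : T) p :
  uniq (x :: p) -> (1 < size p)%N -> #|cycle_edges x p| = (size p).+1.
Proof.
move=> uxp sp; rewrite cardsU1 card_path_edges // (_ : _ \notin _) //.
case: p uxp sp => // y [//|z q]; rewrite cons_uniq => /andP[xN uq] _.
rewrite -[path_edges x _]/([set x; y] |: path_edges y (z :: q)).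
rewrite in_setU1 negb_or notin_path_edges // andbT.
apply/eqP => /setP /(_ (last x [:: y, z & q])); rewrite set22 !inE.
case/esym/orP => /eqP eq_last.
  by move: xN; rewrite -eq_last /= inE mem_last orbT.
by move: uq; rewrite -eq_last /= mem_last.
Qed.

Lemma path_edges_sub (T : finType) (G : {set {set T}}) x p :
  path (fun y z => [set y; z] \in G) x p -> path_edges x p \subset G.
Proof.
elim: p x => [|y q IH] x /=; first by rewrite sub0set.
by case/andP=> xy /IH; rewrite subUset sub1set xy.
Qed.

Lemma path_edges_pairs n (x : 'I_n) p :
  uniq (x :: p) -> path_edges x p \subset vertex_pairs n.
Proof.
elim: p x => [|y q IH] x; first by rewrite sub0set.
rewrite cons_uniq => /andP[xN uq] /=.
rewrite subUset IH // andbT sub1set inE cards2.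
by move: xN; rewrite inE negb_or => /andP[->].
Qed.

Lemma cycle_edges_pairs n (x : 'I_n) p :
  uniq (x :: p) -> (0 < size p)%N -> cycle_edges x p \subset vertex_pairs n.
Proof.
move=> uxp; rewrite /cycle_edges subUset path_edges_pairs // andbT sub1set inE cards2.
case: p uxp => // y q; rewrite cons_uniq => /andP[xN _] _ /=.
by rewrite (_ : x != _) //; apply: contraNneq xN => ->; exact: mem_last.
Qed.

(** * Counting the edges of a graph with small components *)

Definition pairs_in n (S : {set 'I_n}) : {set {set 'I_n}} :=
  [set e in vertex_pairs n | e \subset S].

Definition edge_rel (T : finType) (H : {set {set T}}) : rel T :=
  fun x y => [set x; y] \in H.

Lemma edge_rel_sym (T : finType) (H : {set {set T}}) : symmetric (edge_rel H).
Proof. by move=> x y; rewrite /edge_rel setUC. Qed.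

Lemma connect_edge_sym (T : finType) (H : {set {set T}}) :
  connect_sym (edge_rel H).
Proof. exact/sym_connect_sym/edge_rel_sym. Qed.

(** The edge e0 is the first one of a simple path from v to r: the path never
returns to v, so it uses no other edge at v.  Choosing such an edge for each
vertex plays the role of the parent map of a spanning forest. *)
Lemma parent_edge (T : finType) (H : {set {set T}}) v r :
  connect (edge_rel H) v r ->
  exists e0 : {set T},
    forall e : {set T}, v \in e -> e != e0 -> connect (edge_rel (H :\ e)) v r.
Proof.
case/connectP => p0 Hp0 ->; case/shortenP: Hp0 => p Hp up _ {p0}.
(* If the path is empty, v = r and any value works, here [set v; v]. *)
exists [set v; head v p] => e ve ne.
apply/connectP; exists p => //.
case: p Hp up ne => //= y q /andP[vy yq] /andP[vN _] ne.
rewrite {1}/edge_rel in_setD1 eq_sym ne [_ \in H]vy /=.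
elim: q y yq vN {vy ne} => //= z q IH y /andP[yz zq] vN.
have vN' : v \notin z :: q by apply: contra vN => h; rewrite inE h orbT.
rewrite IH // andbT /edge_rel in_setD1 [_ \in H]yz andbT.
apply: contraNneq vN => E; move: ve; rewrite -E.
by rewrite !inE orbA => ->.
Qed.

(** Simple cycles with k + 1 vertices, each counted once for every root and
orientation.  The root and the last vertex are the ends of the closing edge, so
each edge lying on such a cycle is the closing edge of one of them; with fewer
than three vertices the closing edge would be degenerate or a path edge. *)
Definition short_cycles n (G : {set {set 'I_n}}) k : {set k.+1.-tuple 'I_n} :=
  [set c : k.+1.-tuple 'I_n | [&& uniq c, (1 < k)%N &
     cycle_edges (thead c) (behead c) \subset G]].

(** Every edge e = {u, v} is the parent edge of u, or that of v, or the closing edge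
of a cycle: in the remaining case u and v both still reach their common root
after the removal of e, hence a simple path avoiding e joins them.  There are at
most |S| parent edges. *)
Lemma forest_or_cycle n (H : {set {set 'I_n}}) (S : {set 'I_n}) T :
  H \subset pairs_in S ->
  (forall x p, path (edge_rel H) x p -> uniq (x :: p) -> x \in S ->
     (size p < T)%N) ->
  (#|H| <= #|S| + \sum_(k < T) #|short_cycles H k|)%N.
Proof.
move=> /subsetP HS short.
have [f Hf] := choice (fun v =>
  parent_edge (connect_root (edge_rel H) v)).
pose cyc (k : 'I_T) := [set [set thead c; last (thead c) (behead c)] |
   c in short_cycles H k].
have sub : H \subset f @: S :|: \bigcup_(k < T) cyc k.
  apply/subsetP => e He; rewrite inE.
  have := HS e He; rewrite !inE => /andP[/cards2P[u [v [uv Ee]]] eS].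
  have [uS vS] : u \in S /\ v \in S.
    by split; apply: (subsetP eS); rewrite Ee !inE eqxx ?orbT.
  have [->|nfu] := eqVneq e (f u); first by rewrite imset_f.
  have [->|nfv] := eqVneq e (f v); first by rewrite imset_f.
  apply/orP; right.
  have ruv : fingraph.root (edge_rel H) u = fingraph.root (edge_rel H) v.
    apply/(fingraph.rootP (@connect_edge_sym _ H)); apply: connect1.
    by rewrite /edge_rel -Ee.
  have cu := Hf u e; have cv := Hf v e.
  have : connect (edge_rel (H :\ e)) u v.
    apply: connect_trans (cu _ nfu) _; first by rewrite Ee set21.
    by rewrite ruv connect_edge_sym; apply: cv nfv; rewrite Ee set22.
  case/connectP => p0 Hp0 Ev; move: Ev; case/shortenP: Hp0 => p Hp up _ Ev.
  have HpH : path (edge_rel H) u p.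
    by apply: sub_path Hp => x y; rewrite /edge_rel in_setD1 => /andP[].
  have kT := short u p HpH up uS.
  (* The cycle is the path from u to v avoiding e, closed by e itself. *)
  apply/bigcupP; exists (Ordinal kT) => //.
  apply/imsetP; exists (in_tuple (u :: p)); last first.
    by rewrite /thead (tnth_nth u) /= -Ev.
  rewrite inE up /thead (tnth_nth u) /= /cycle_edges subUset sub1set -Ev -Ee He.
  rewrite path_edges_sub // !andbT.
  (* A path with at most one edge would be e, or would have u = v. *)
  case: p Hp Ev {up HpH kT} => [|y [|//]] /=; first by move=> _ E; rewrite E eqxx in uv.
  by rewrite andbT /edge_rel in_setD1 => /andP[h _] E; rewrite -E -Ee eqxx in h.
apply: leq_trans (subset_leq_card sub) _.
apply: leq_trans (leq_card_setU _ _) _.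
apply: leq_add; first exact: leq_imset_card.
elim/big_ind2: _ => [|A a B b HA HB|k _]; first by rewrite cards0.
  by apply: leq_trans (leq_card_setU _ _) _; apply: leq_add.
exact: leq_imset_card.
Qed.

(** The subset S' is there because the union bound runs over sets of one fixed
size: cycles inside S' lie inside a component of S, so the bound on their length
is inherited. *)
Lemma edges_small_components n (G : {set {set 'I_n}}) (S S' : {set 'I_n}) T :
  S' \subset S -> {in components G S, forall C : {set 'I_n}, #|C| <= T}%N ->
  (#|G :&: pairs_in S'| <= #|S'| + \sum_(k < T) #|short_cycles G k|)%N.
Proof.
move=> /subsetP S'S small; set H := G :&: _.
apply: (@leq_trans (#|S'| + \sum_(k < T) #|short_cycles H k|)%N); last first.
  rewrite leq_add2l; apply: leq_sum => k _; apply: subset_leq_card.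
  apply/subsetP => c; rewrite !inE => /and3P[-> -> /subset_trans -> //].
  exact: subsetIl.
apply: forest_or_cycle; first exact: subsetIr.
move=> x p Hp up xS'.
pose C := [set y in S | connect (induced_adj G S) x y].
have CS : C \in components G S by apply/imsetP; exists x => //; exact: S'S.
apply: leq_trans (small C CS); rewrite -[(size p).+1]/(size (x :: p)).
rewrite -(card_uniqP up); apply: subset_leq_card; apply/subsetP => y yp.
have sub : subrel (edge_rel H) (induced_adj G S).
  move=> a b; rewrite /edge_rel /induced_adj !inE => /and3P[-> _ /subsetP h].
  by rewrite !S'S // h // !inE eqxx ?orbT.
have Hp' := sub_path sub Hp.
have xy := path_connect Hp' yp.
rewrite inE xy andbT.
have [->|yx] := eqVneq y x; first exact: S'S.
move: yp; rewrite inE (negPf yx) /= => yp.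
case/splitPr: yp Hp' => p1 p2; rewrite cat_path /= => /and3P[_].
by case/and3P.
Qed.

(** * Expectations in the random graph *)

(** Expansion of a product of sums, restricted to the subsets of V; with weights
that depend on the presence of each edge, it expresses their independence. *)
Lemma sum_subset_prod (R : comNzRingType) (T : finType) (V : {set T}) (a b : T -> R) :
  \sum_(G : {set T} | G \subset V) \prod_(e in V) (if e \in G then a e else b e)
  = \prod_(e in V) (a e + b e).
Proof.
(* Outside V the factor 0 + 1 kills the sets that are not contained in V. *)
pose a' e := if e \in V then a e else 0; pose b' e := if e \in V then b e else 1.
transitivity (\prod_e (a' e + b' e)); last first.
  rewrite [RHS]big_mkcond; apply: eq_bigr => e _; rewrite /a' /b'.
  by case: ifP; rewrite ?add0r.
rewrite bigA_distr big_mkcond; apply: eq_bigr => G _.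
case: ifPn => [/subsetP GV | /subsetPn[e eG eV]].
  rewrite big_mkcond; apply: eq_bigr => e _; rewrite /a' /b'.
  by case: ifPn => [//|eV]; rewrite (contraNF (GV e) eV).
by rewrite (bigD1 e) //= eG /a' (negPf eV) mul0r.
Qed.

Section Expectation.
Variables (R : realType) (n : nat) (p : R).
Implicit Types (G : {set {set 'I_n}}) (f : {set {set 'I_n}} -> R).

Definition ER_weight G : R :=
  \prod_(e in vertex_pairs n) (if e \in G then p else 1 - p).

Definition ER_exp f : R :=
  \sum_(G : {set {set 'I_n}} | G \subset vertex_pairs n) ER_weight G * f G.

Lemma ER_exp_prod (a b : {set 'I_n} -> R) :
  ER_exp (fun G => \prod_(e in vertex_pairs n) (if e \in G then a e else b e)) =
  \prod_(e in vertex_pairs n) (p * a e + (1 - p) * b e).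
Proof.
rewrite -sum_subset_prod; apply: eq_bigr => G _.
by rewrite -big_split; apply: eq_bigr => e _ /=; case: ifP.
Qed.

Lemma ER_exp_subset (F : {set {set 'I_n}}) : F \subset vertex_pairs n ->
  ER_exp (fun G => (F \subset G)%:R) = p ^+ #|F|.
Proof.
move=> FV; under [LHS]eq_bigr => G _.
  rewrite (_ : (F \subset G)%:R = \prod_(e in vertex_pairs n)
    (if e \in G then 1 else (e \notin F)%:R)); last first.
    case: (boolP (F \subset G)) => [/subsetP FG | /subsetPn[e eF eG]].
      rewrite big1 // => e _; case: ifPn => // eG.
      by rewrite (contra (FG e) eG).
    by rewrite (bigD1 e) ?(subsetP FV) //= (negPf eG) eF mul0r.
  over.
rewrite -/(ER_exp _) ER_exp_prod.
rewrite (eq_bigr (fun e => if e \in F then p else 1)) => [|e _]; last first.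
  by case: (e \in F) => /=; rewrite mulr1 ?mulr0 ?addr0 // mulr1 addrC subrK.
rewrite -big_mkcondr /= (eq_bigl (mem F)) ?prodr_const // => e /=.
by case: (boolP (e \in F)) => [/(subsetP FV) -> //|]; rewrite andbF.
Qed.

(** The moment generating function of a binomial variable, in the variable
t = exp of the usual parameter. *)
Lemma ER_exp_moment (K : {set {set 'I_n}}) (t : R) : K \subset vertex_pairs n ->
  ER_exp (fun G => t ^+ #|G :&: K|) = (p * t + (1 - p)) ^+ #|K|.
Proof.
move=> KV; under [LHS]eq_bigr => G GV.
  rewrite (_ : t ^+ _ = \prod_(e in vertex_pairs n)
    (if e \in G then if e \in K then t else 1 else 1)); last first.
    rewrite -prodr_const [LHS]big_mkcond [RHS]big_mkcond /=.
    apply: eq_bigr => e _; rewrite inE.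
    case: (boolP (e \in G)) => /= [eG|_]; last by rewrite if_same.
    by rewrite (subsetP GV).
  over.
rewrite -/(ER_exp _) ER_exp_prod -prodr_const.
rewrite [RHS]big_mkcond [LHS]big_mkcond; apply: eq_bigr => e _ /=.
case: ifPn => [_|eV]; last by rewrite (contraNF (subsetP KV e) eV).
by case: ifP => _; rewrite !mulr1 // addrC subrK.
Qed.

Lemma ER_exp1 : ER_exp (fun=> 1) = 1.
Proof.
rewrite -[RHS](expr0 p) -(cards0 {set 'I_n}) -ER_exp_subset ?sub0set //.
by apply: eq_bigr => G _; rewrite sub0set.
Qed.

Lemma ER_expZ (c : R) f : ER_exp (fun G => c * f G) = c * ER_exp f.
Proof. by rewrite /ER_exp mulr_sumr; apply: eq_bigr => G _; rewrite mulrCA. Qed.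

Lemma ER_expD f g : ER_exp (fun G => f G + g G) = ER_exp f + ER_exp g.
Proof. by rewrite -big_split; apply: eq_bigr => G _; rewrite mulrDr. Qed.

Lemma ER_exp_sum (I : Type) (r : seq I) (P : pred I) (F : I -> {set {set 'I_n}} -> R) :
  ER_exp (fun G => \sum_(i <- r | P i) F i G) = \sum_(i <- r | P i) ER_exp (F i).
Proof.
by rewrite exchange_big; apply: eq_bigr => G _; rewrite mulr_sumr.
Qed.

Lemma ER_probE (A : pred {set {set 'I_n}}) :
  ER_prob p A = ER_exp (fun G => (A G)%:R).
Proof.
rewrite /ER_prob big_mkcondr; apply: eq_bigr => G _.
by case: (A G); rewrite ?mulr1 ?mulr0.
Qed.

Hypothesis p01 : 0 <= p <= 1.

Lemma ER_weight_ge0 G : 0 <= ER_weight G.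
Proof.
by case/andP: p01 => p0 p1; apply: prodr_ge0 => e _; case: ifP; rewrite ?subr_ge0.
Qed.

Lemma ler_ER_exp f g :
  (forall G, G \subset vertex_pairs n -> f G <= g G) -> ER_exp f <= ER_exp g.
Proof.
by move=> fg; apply: ler_sum => G GV; apply: ler_wpM2l (fg G GV); exact: ER_weight_ge0.
Qed.

Lemma ER_prob_le1 (A : pred {set {set 'I_n}}) : ER_prob p A <= 1.
Proof.
rewrite ER_probE -[leRHS]ER_exp1; apply: ler_ER_exp => G _.
by rewrite lern1 leq_b1.
Qed.

(** The first moment method: f dominates the indicator of the complement of A. *)
Lemma ER_prob_ge (A : pred {set {set 'I_n}}) f :
  (forall G, 0 <= f G) -> (forall G, ~~ A G -> 1 <= f G) ->
  1 - ER_exp f <= ER_prob p A.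
Proof.
move=> f0 f1; rewrite lerBlDr ER_probE -ER_expD -[leLHS]ER_exp1.
apply: ler_ER_exp => G _; have := f1 G; have := f0 G.
by case: (A G) => /= [? _|_ h]; rewrite ?lerDl ?add0r ?h.
Qed.

(** There are n ^ (k + 1) tuples, and each one that is a cycle has k + 1 distinct
edges. *)
Lemma ER_exp_short_cycles k :
  ER_exp (fun G => #|short_cycles G k|%:R) <= (n%:R * p) ^+ k.+1.
Proof.
have p0 : 0 <= p by case/andP: p01.
have count G : #|short_cycles G k|%:R = \sum_(c : k.+1.-tuple 'I_n)
    (uniq c && (1 < k)%N)%:R * (cycle_edges (thead c) (behead c) \subset G)%:R :> R.
  rewrite -sum1_card natr_sum big_mkcond; apply: eq_bigr => c _.
  by rewrite inE andbA -natrM mulnb; case: (_ && _).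
rewrite [leLHS](eq_bigr _ (fun G _ => congr1 (fun x => ER_weight G * x) (count G))).
rewrite -/(ER_exp _) ER_exp_sum.
have card_tup : #|{: k.+1.-tuple 'I_n}|%:R = n%:R ^+ k.+1 :> R.
  by rewrite card_tuple card_ord natrX.
rewrite exprMn -card_tup mulr_natl -sumr_const; apply: ler_sum => c _.
rewrite ER_expZ; case: (boolP (uniq c)) => /= [uc|_]; last by rewrite mul0r exprn_ge0.
case: (ltnP 1 k) => k1; last by rewrite mul0r exprn_ge0.
case/tupleP: c uc => x c; rewrite theadE /= -/(uniq (x :: c)) => uc.
rewrite mul1r ER_exp_subset ?card_cycle_edges ?size_tuple //.
by apply: cycle_edges_pairs; rewrite ?size_tuple ?(ltnW k1).
Qed.

End Expectation.

Lemma pairs_in_sub n (S : {set 'I_n}) : pairs_in S \subset vertex_pairs n.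
Proof. by apply/subsetP => e; rewrite inE => /andP[]. Qed.

Lemma card_pairs_in n (S : {set 'I_n}) : #|pairs_in S| = 'C(#|S|, 2).
Proof.
by rewrite -cards_draws; congr #|pred_of_set _|; apply/setP => e; rewrite !inE andbC.
Qed.

(** * Estimates on real numbers *)

Section Numerics.
Variable R : realType.
Implicit Types (d x alpha L eps omega tau : R).

(** With x = alpha and s close to alpha n this bounds the binomial coefficient by
exp of n (ln (1 + alpha) - alpha ln alpha).  The usual (e n / s) ^ s amounts to
replacing ln (1 + alpha) by alpha; that loss would leave no slack in the
exponent. *)
Lemma bin_expr_le n s x : 0 <= x -> 'C(n, s)%:R * x ^+ s <= (1 + x) ^+ n.
Proof.
move=> x0; rewrite exprDn.
have pos (i : 'I_n.+1) : 0 <= 1 ^+ (n - i) * x ^+ i *+ 'C(n, i) :> R.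
  by rewrite mulrn_wge0 // expr1n mul1r exprn_ge0.
case: (ltnP s n.+1) => [sn|ns]; last first.
  by rewrite bin_small // mul0r sumr_ge0.
rewrite (bigD1 (Ordinal sn)) //= expr1n mul1r mulr_natl lerDl.
exact: sumr_ge0.
Qed.

Lemma bin2R s : 'C(s, 2)%:R = s%:R * (s%:R - 1) / 2 :> R.
Proof.
elim: s => [|s IH]; first by rewrite mul0r mul0r.
by rewrite binS natrD IH bin1 -natr1; field.
Qed.

(** This is where the constant alpha comes from.  With s = alpha n, the terms
- s ln alpha + s ln L equal s ln (d / 2) = alpha n (L - 2), whereas the expected
number of edges contributes alpha n (L - 1) since d alpha / 2 = L; the difference
- alpha n competes with ln (1 + alpha) n.  The constant 2 L - 3 pays for the
rounding of s and for s (s - 1) in place of s ^ 2. *)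
Lemma entropy_exponent n s d eps L alpha :
  (0 < n)%N -> 0 < d -> L = ln d + 2 - ln 2 -> 2 <= L -> alpha = 2 / d * L ->
  alpha * n%:R <= s%:R <= alpha * n%:R + 1 -> (0 < s)%N ->
  ln (1 + alpha) * n%:R - ln alpha * s%:R + ln L * (s%:R + eps * n%:R)
     - d / n%:R * (1 - L^-1) * 'C(s, 2)%:R
  <= 2 * L - 3 - n%:R * (alpha - ln (1 + alpha) - eps * ln L).
Proof.
move=> n0 d0 EL L2 Ealpha /andP[s_ge s_le] s0.
have nR : 0 < n%:R :> R by rewrite ltr0n.
have sR : 1 <= s%:R :> R by rewrite ler1n.
have L0 : 0 < L by lra.
have alpha0 : 0 < alpha by rewrite Ealpha !mulr_gt0 ?invr_gt0.
have Elna : ln alpha = ln L - (L - 2).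
  rewrite Ealpha lnM ?posrE ?mulr_gt0 ?invr_gt0 // ln_div ?posrE // EL; ring.
have entropy : s%:R * (L - 2) <= (alpha * n%:R + 1) * (L - 2).
  by rewrite ler_wpM2r ?subr_ge0.
have edges : (alpha * n%:R - 1) * (L - 1) <= d / n%:R * (1 - L^-1) * 'C(s, 2)%:R.
  have -> : (alpha * n%:R - 1) * (L - 1) =
      d / n%:R * (1 - L^-1) * (alpha * n%:R * (alpha * n%:R - 1) / 2).
    by rewrite {2}Ealpha; field; rewrite !gt_eqF.
  rewrite bin2R ler_wpM2l //.
    rewrite mulr_ge0 ?divr_ge0 ?subr_ge0 ?invf_le1 ?ltW //; lra.
  rewrite ler_pM2r ?invr_gt0 //.
  have an0 : 0 <= alpha * n%:R by rewrite mulr_ge0 // ltW.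
  nra.
rewrite Elna; nra.
Qed.

(** The expected number of s-sets with at most s + eps n edges, after Chernoff's
bound: the binomial coefficient is controlled by bin_expr_le and
1 - x <= exp (- x) is applied to each pair. *)
Lemma first_moment_le n s d eps L alpha :
  (0 < n)%N -> 0 < d <= n%:R -> L = ln d + 2 - ln 2 -> 2 <= L -> alpha = 2 / d * L ->
  alpha * n%:R <= s%:R <= alpha * n%:R + 1 -> (0 < s)%N ->
  'C(n, s)%:R * (expR (ln L * (s%:R + eps * n%:R)) *
     (d / n%:R * L^-1 + (1 - d / n%:R)) ^+ 'C(s, 2))
  <= expR (2 * L - 3 - n%:R * (alpha - ln (1 + alpha) - eps * ln L)).
Proof.
move=> n0 /andP[d0 dn] EL L2 Ealpha s_itv s0.
have nR : 0 < n%:R :> R by rewrite ltr0n.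
have L0 : 0 < L by lra.
have alpha0 : 0 < alpha by rewrite Ealpha !mulr_gt0 ?invr_gt0.
apply: le_trans (_ : expR _ <= _); last first.
  rewrite ler_expR; exact: (@entropy_exponent n s d eps L alpha).
have q0 : 0 <= d / n%:R * L^-1 + (1 - d / n%:R).
  by rewrite addr_ge0 ?mulr_ge0 ?invr_ge0 ?subr_ge0 ?ler_pdivrMr ?mul1r // ltW.
rewrite expRD expRD (expRD (_ * n%:R)) [leLHS]mulrA; apply: ler_pM.
- by rewrite mulr_ge0 ?expR_ge0.
- exact: exprn_ge0.
- rewrite ler_pM2r ?expR_gt0 // expRN !expRM_natr !lnK ?posrE ?addr_gt0 //.
  by rewrite ler_pdivlMr ?exprn_gt0 //; apply: bin_expr_le; exact: ltW.
rewrite -[- (_ * 'C(s, 2)%:R)]mulNr expRM_natr lerXn2r ?nnegrE ?expR_ge0 //.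
by apply: le_trans (expR_ge1Dx _); rewrite le_eqVlt; apply/orP; left; apply/eqP; ring.
Qed.

Lemma geom_sum_le d T : 2 <= d -> \sum_(k < T) d ^+ k.+1 <= 2 * d ^+ T.
Proof.
move=> d2; elim: T => [|T IH]; first by rewrite big_ord0 mulr_ge0.
rewrite big_ord_recr /=; apply: le_trans (lerD IH (lexx _)) _.
have x0 : 0 <= d ^+ T by rewrite exprn_ge0 //; lra.
by rewrite exprS; nra.
Qed.

(** Since exp (- 1 / 2) >= 1 / 2, the number e is at most 4. *)
Lemma ln_ge1 d : 5 <= d -> 1 <= ln d.
Proof.
move=> d5; have d0 : 0 < d by lra.
rewrite -ler_expR lnK ?posrE //.
have h : expR (2^-1) <= 2 :> R.
  rewrite -[leLHS]invrK -expRN -[leRHS]invrK lef_pV2 ?posrE ?expR_gt0 ?invr_gt0 //.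
  by apply: le_trans (expR_ge1Dx _); lra.
have -> : (1 : R) = 2^-1 + 2^-1 by field.
rewrite expRD; have := expR_gt0 (2^-1 : R); nra.
Qed.

(** Since ln d >= 1, the term - ln omega in the bound on tau gains at least a
factor omega in d ^ tau.  The summand 1 covers a negative tau, for which truncation gives the
exponent 0. *)
Lemma expr_cycle_length_le n d omega tau : (0 < n)%N -> 5 <= d -> 1 <= omega ->
  tau <= log_base d n%:R - ln omega ->
  d ^+ Num.trunc tau <= 1 + n%:R / omega.
Proof.
move=> n0 d5 w1 htau.
have nR : 0 < n%:R :> R by rewrite ltr0n.
have d0 : 0 < d by lra.
have w0 : 0 < omega by lra.
have [tau0|tau0] := ltP tau 0.
  have -> : Num.trunc tau = 0%N.
    by apply/eqP; rewrite -leqn0 truncn_le_nat; lra.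
  by rewrite lerDl divr_ge0 // ltW.
have ld := ln_ge1 d5.
have ld0 : 0 < ln d by lra.
apply: (@le_trans _ _ (n%:R / omega)); last by rewrite lerDr.
have -> : n%:R / omega = expR (ln n%:R - ln omega).
  by rewrite expRD expRN !lnK.
rewrite -[d in d ^+ _](lnK (x := d)) // -expRM_natr ler_expR.
have [T_le _] := andP (trunc_itv tau0).
apply: (@le_trans _ _ (ln d * (log_base d n%:R - ln omega))).
  by rewrite ler_pM2l //; apply: le_trans T_le htau.
have -> : ln d * (log_base d n%:R - ln omega) = ln n%:R - ln d * ln omega.
  by rewrite /log_base; field; rewrite gt_eqF.
rewrite lerB // ler_peMl // ln_ge0 //.
Qed.

End Numerics.

(** * The union bound and the limit *)

Lemma subset_of_card (T : finType) (A : {set T}) k :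
  (k <= #|A|)%N -> exists2 B : {set T}, B \subset A & #|B| = k.
Proof.
case/card_geqP => s [us <- sA]; exists [set x in s].
  by apply/subsetP => x; rewrite inE; apply: sA.
by rewrite cardsE; apply/card_uniqP.
Qed.

(** A graph violating the property has either at least eps n short cycles, or a set
of size s with at most s + eps n edges; X / (eps n) is at least 1 in the first case,
and one Chernoff weight in Y is at least 1 in the second.  The parameter
t = 1 / L of the weights is the optimal one: it is the ratio of the allowed number
of edges alpha n to the expected one d alpha ^ 2 n / 2. *)
Lemma ER_prob_small_components_ge (R : realType) (n : nat) (d eps L alpha omega tau : R) :
  (0 < n)%N -> 5 <= d <= n%:R -> 0 < eps -> 1 <= omega ->
  L = ln d + 2 - ln 2 -> 2 <= L -> alpha = 2 / d * L ->
  tau <= log_base d n%:R - ln omega ->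
  1 - (2 * (1 + n%:R / omega) / (eps * n%:R) +
       expR (2 * L - 3 - n%:R * (alpha - ln (1 + alpha) - eps * ln L)))
  <= ER_prob (d / n%:R) (fun G : {set {set 'I_n}} => [forall S : {set 'I_n},
        [forall C in components G S, #|C|%:R <= tau] ==>
        (#|S|%:R <= alpha * n%:R)]).
Proof.
move=> n0 /andP[d5 dn] eps0 w1 EL L2 Ealpha htau.
have nR : 0 < n%:R :> R by rewrite ltr0n.
have [d0 L0] : 0 < d /\ 0 < L by split; lra.
have en0 : 0 < eps * n%:R by rewrite mulr_gt0.
have p01 : 0 <= d / n%:R <= 1.
  by rewrite (divr_ge0 (ltW d0) (ltW nR)) ler_pdivrMr ?mul1r.
have an0 : 0 <= alpha * n%:R.
  by rewrite Ealpha; repeat apply: mulr_ge0; rewrite ?invr_ge0 ltW.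
pose s := (Num.trunc (alpha * n%:R)).+1.
have s_itv : alpha * n%:R <= s%:R <= alpha * n%:R + 1.
  have /andP[h1 h2] := trunc_itv an0.
  by rewrite (ltW h2) /= -natr1 lerD2r.
pose T := Num.trunc tau.
pose X (G : {set {set 'I_n}}) : R := \sum_(k < T) #|short_cycles G k|%:R.
pose Y (G : {set {set 'I_n}}) : R := \sum_(S : {set 'I_n} | #|S| == s)
   expR (ln L * (s%:R + eps * n%:R)) * L^-1 ^+ #|G :&: pairs_in S|.
pose f G := (eps * n%:R)^-1 * X G + Y G.
have X0 G : 0 <= X G by apply: sumr_ge0.
have Yt0 G (S : {set 'I_n}) :
    0 <= expR (ln L * (s%:R + eps * n%:R)) * L^-1 ^+ #|G :&: pairs_in S|.
  by rewrite mulr_ge0 ?expR_ge0 // exprn_ge0 // invr_ge0 ltW.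
have Y0 G : 0 <= Y G by apply: sumr_ge0.
have cX0 G : 0 <= (eps * n%:R)^-1 * X G by rewrite mulr_ge0 // invr_ge0 ltW.
apply: le_trans (ER_prob_ge p01 (f := f) _ _); last 2 first.
- by move=> G; rewrite addr_ge0.
- move=> G; rewrite negb_forall => /existsP[S]; rewrite negb_imply -ltNge.
  case/andP=> /forall_inP small Sbig.
  have [enX|Xen] := leP (eps * n%:R) (X G).
    by rewrite -[leLHS]addr0 lerD // mulrC ler_pdivlMr ?mul1r.
  rewrite -[leLHS]add0r lerD //.
  have [|S' S'S cardS'] := @subset_of_card _ S s.
    by rewrite /s truncn_lt_nat.
  have small' : {in components G S, forall C : {set 'I_n}, (#|C| <= T)%N}.
    move=> C /small CT; rewrite truncn_ge_nat //; exact: le_trans CT.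
  have := edges_small_components S'S small'.
  rewrite -(ler_nat R) natrD natr_sum cardS' -/(X G) => edges.
  rewrite /Y (bigD1 S') ?cardS' //= -[leLHS]addr0 lerD //; last exact: sumr_ge0.
  rewrite -[L in L^-1](lnK (x := L)) // -expRN -expRM_natr -expRD -[leLHS]expR0.
  have lnL0 : 0 <= ln L by rewrite ln_ge0 //; lra.
  by rewrite ler_expR; nra.
rewrite lerD2l lerN2 ER_expD ER_expZ lerD //.
  rewrite mulrC ler_pM2r ?invr_gt0 // ER_exp_sum.
  apply: (@le_trans _ _ (2 * d ^+ T)); last by rewrite ler_pM2l // expr_cycle_length_le.
  apply: (@le_trans _ _ (\sum_(k < T) d ^+ k.+1)); last by apply: geom_sum_le; lra.
  apply: ler_sum => k _; apply: le_trans (ER_exp_short_cycles n p01 k) _.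
  by rewrite mulrCA divff ?gt_eqF // mulr1.
rewrite ER_exp_sum.
rewrite (eq_bigr (fun=> expR (ln L * (s%:R + eps * n%:R)) *
     (d / n%:R * L^-1 + (1 - d / n%:R)) ^+ 'C(s, 2))) => [|S /eqP cS].
  rewrite sumr_const (eq_card (B := [set S : {set 'I_n} | #|S| == s])); last first.
    by move=> S; rewrite !inE.
  rewrite card_draws card_ord -[leLHS]mulr_natl.
  by apply: first_moment_le => //; rewrite d0.
by rewrite ER_expZ ER_exp_moment ?pairs_in_sub // card_pairs_in cS.
Qed.

Lemma cvg_inv_to0 (R : realType) (u : nat -> R) :
  (u n @[n --> \oo] --> +oo)%classic -> ((u n)^-1 @[n --> \oo] --> (0 : R))%classic.
Proof. by move=> uy; apply/gtr0_cvgV0 => //; exact: cvgry_gt. Qed.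

Theorem theorem2 (R : realType) (d : R) (omega tau : nat -> R)
    (hd : 5 <= d)
    (homega : (omega n @[n --> \oo] --> +oo)%classic)
    (htau : forall n : nat,
        tau n = log_base d n%:R - ln (ln (ln n%:R)) - ln (omega n)) :
  with_high_probability (fun n : nat => d / n%:R)
    (fun n (G : {set {set 'I_n}}) =>
      [forall S : {set 'I_n},
        [forall C in components G S, #|C|%:R <= tau n] ==>
        (#|S|%:R <= 2 / d * (ln d + 2 - ln 2) * n%:R)]).
Proof.
have d0 : 0 < d by lra.
set L := ln d + 2 - ln 2; set alpha := 2 / d * L.
have L2 : 2 < L.
  have : ln 2 < ln d by rewrite ltr_ln ?posrE //; lra.
  by rewrite /L; lra.
have L0 : 0 < L by lra.
have alpha0 : 0 < alpha by rewrite !mulr_gt0 ?invr_gt0.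
have lnL0 : 0 < ln L by rewrite ln_gt0 //; lra.
have gap : 0 < alpha - ln (1 + alpha).
  rewrite subr_gt0 -ltr_expR lnK ?posrE ?addr_gt0 // expR_gt1Dx ?gt_eqF //.
pose delta := (alpha - ln (1 + alpha)) / 2.
(* Spends half of the gap between alpha and ln (1 + alpha) on the short cycles. *)
pose eps := delta / ln L.
have delta0 : 0 < delta by rewrite divr_gt0.
have eps0 : 0 < eps by rewrite divr_gt0.
have Edelta : alpha - ln (1 + alpha) - eps * ln L = delta.
  by rewrite divfK ?gt_eqF // /delta; field.
pose M := expR (2 * L - 3) / delta + 2 / eps.
rewrite /with_high_probability.
apply: (squeeze_cvgr (h := fun=> 1) (f :=
  (fun n => 1 - (M * n%:R^-1 + 2 / eps * (omega n)^-1)))).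
- near=> n; apply/andP; split; last first.
    apply: ER_prob_le1; rewrite divr_ge0 ?ler0n ?(ltW d0) //= ler_pdivrMr ?mul1r.
      by near: n; exact: nbhs_infty_ger.
    by rewrite ltr0n; near: n; exact: nbhs_infty_gt.
  have n0 : (0 < n)%N by near: n; exact: nbhs_infty_gt.
  have nR : 0 < n%:R :> R by rewrite ltr0n.
  have w1 : 1 <= omega n by near: n; exact: cvgry_ge.
  have w0 : 0 < omega n by lra.
  have tau_le : tau n <= log_base d n%:R - ln (omega n).
    rewrite htau lerD2r lerBlDr lerDl.
    have ge_ln (x y : R) : expR x <= y -> x <= ln y.
      by move=> xy; rewrite -ler_expR lnK // posrE (lt_le_trans (expR_gt0 x)).
    (* The triple logarithm is nonnegative once n >= exp (exp 1). *)
    apply/ln_ge0/ge_ln/ge_ln.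
    by near: n; exact: nbhs_infty_ger.
  have dn : 5 <= d <= n%:R.
    by rewrite hd /=; near: n; exact: nbhs_infty_ger.
  apply: le_trans (ER_prob_small_components_ge n0 dn eps0 w1 erefl (ltW L2) erefl tau_le).
  rewrite Edelta lerD2l lerN2 -/L -/alpha.
  have -> : M * n%:R^-1 + 2 / eps * (omega n)^-1 =
     2 * (1 + n%:R / omega n) / (eps * n%:R) + expR (2 * L - 3) / (n%:R * delta).
    by rewrite /M; field; rewrite !gt_eqF.
  (* The decay exp (- n delta) <= 1 / (n delta) is enough. *)
  rewrite lerD2l expRD ler_pM2l ?expR_gt0 // expRN lef_pV2 ?posrE ?expR_gt0 ?mulr_gt0 //.
  apply: le_trans (expR_ge1Dx _); rewrite lerDr //.
- rewrite -[X in (_ --> X)%classic]subr0; apply: cvgB; first exact: cvg_cst.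
  rewrite -[X in (_ --> X)%classic](addr0 0).
  apply: cvgD.
    rewrite -[X in (_ --> X)%classic](mulr0 M); apply: cvgM; first exact: cvg_cst.
    exact: (cvg_inv_to0 cvgr_idn).
  rewrite -[X in (_ --> X)%classic](mulr0 (2 / eps)); apply: cvgM; first exact: cvg_cst.
  exact: cvg_inv_to0.
- exact: cvg_cst.
Unshelve. all: by end_near.
Qed.
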